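(* The sets of occupation measures generated by joint mixtures of decentralized behavioral policy-profiles and by joint mixtures of decentralized pure policy-profiles coincide: $$\mathbf{p}_\infty^{(1)}\big(\mathcal{M}_1(\mathcal{U})\big)=\mathbf{p}_\infty^{(1)}\big(\mathcal{M}_1(\mathcal{U}_{\mathrm{pure}})\big).$$
   Context: Model. $N\in\mathbb{N}$ agents. The state space $\mathcal{S}$ is a topological space with Borel $\sigma$-algebra $\mathcal{B}(\mathcal{S})$. The joint-observation space $\mathcal{O}=\mathcal{O}^{(0)}\times\mathcal{O}^{(1)}\times\cdots\times\mathcal{O}^{(N)}$ is countable and discrete ($\mathcal{O}^{(0)}$: common observations; $\mathcal{O}^{(n)}$: private observations of agent $n$). The joint-action space $\mathcal{A}=\mathcal{A}^{(1)}\times\cdots\times\mathcal{A}^{(N)}$ is finite and discrete. The initial pair $(S_1,O_1)$ has law $P_1$, a probability measure on $\mathcal{S}\times\mathcal{O}$. Given all past states, observations and actions, and the current $S_t=s$, $A_t=a$, one has $\mathbb{P}(S_{t+1}\in B,O_{t+1}=o\mid\cdot)=P(s,a,B,o)$ for $B\in\mathcal{B}(\mathcal{S})$, $o\in\mathcal{O}$, where $P$ is a fixed transition probability, measurable in $(s,a,o)$ for each $B$. At time $t\in\mathbb{N}$ agent $n$ observes $O_t^{(0)}$ and $O_t^{(n)}$ and then chooses $A_t^{(n)}\in\mathcal{A}^{(n)}$; actions are forever private. Histories. The common history at time $t$ is $h_t^{(0)}=o^{(0)}_{1:t}\in\mathcal{H}_t^{(0)}=(\mathcal{O}^{(0)})^t$.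 The private history of agent $n$ is $h_t^{(n)}=(o^{(n)}_{1:t},a^{(n)}_{1:t-1})\in\mathcal{H}_t^{(n)}=(\mathcal{O}^{(n)})^t\times(\mathcal{A}^{(n)})^{t-1}$. The joint-history is $h_t=(o_{1:t},a_{1:t-1})=(h_t^{(0)},h_t^{(1)},\dots,h_t^{(N)})\in\mathcal{H}_t$. Write $h_t^{(0,n)}=(h_t^{(0)},h_t^{(n)})\in\mathcal{H}_t^{(0,n)}=\mathcal{H}_t^{(0)}\times\mathcal{H}_t^{(n)}$. Policies. $\mathcal{M}_1(Y)$ denotes the set of Borel probability measures on $Y$. A behavioral policy of agent $n$ is $u^{(n)}=(u^{(n)}_t)_{t\ge1}\in\mathcal{U}^{(n)}$ with $u^{(n)}_t:\mathcal{H}_t^{(0,n)}\to\mathcal{M}_1(\mathcal{A}^{(n)})$. It is pure if every $u_t^{(n)}(h_t^{(0,n)})$ is a Dirac measure; $\mathcal{U}^{(n)}_{\mathrm{pure}}\subseteq\mathcal{U}^{(n)}$ is the set of pure policies. $\mathcal{U}=\prod_{n=1}^N\mathcal{U}^{(n)}$ and $\mathcal{U}_{\mathrm{pure}}=\prod_{n=1}^N\mathcal{U}^{(n)}_{\mathrm{pure}}$ are the sets of decentralized behavioral, respectively pure, policy-profiles. Under $u\in\mathcal{U}$, given $h_t$, the joint action $a_t$ is chosen with probability $\prod_{n=1}^N u^{(n)}_t(a^{(n)}_t\mid h^{(0,n)}_t)$ (independently of the current and past states given $h_t$); $\mathbb{P}^{u}_{P_1}$ is the resulting law of $(S_t,O_t,A_t)_{t\ge1}$.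 Topology. $\mathcal{U}$ is identified with $\prod_{n=1}^N\prod_{t\ge1}\prod_{h\in\mathcal{H}_t^{(0,n)}}\mathcal{M}_1(\mathcal{A}^{(n)})$ and has the product topology, each factor having the topology of weak convergence; $\mathcal{U}_{\mathrm{pure}}$ has the subspace topology. Mixtures. $\mu\in\mathcal{M}_1(\mathcal{U})$ (or $\mathcal{M}_1(\mathcal{U}_{\mathrm{pure}})$) is a joint mixture: a policy-profile is drawn from $\mu$ at time $0$ and then used forever, so $\mathbb{P}^{\mu}_{P_1}(h_t,a_t)=\int\mathbb{P}^{u}_{P_1}(h_t,a_t)\,\mu(du)$. Occupation measures. For a mixture $x$, $\mathbf{p}_\infty^{(1)}(x)=\{\mathbb{P}^{x}_{P_1}(h_t,a_t): t\in\mathbb{N},h_t\in\mathcal{H}_t,a_t\in\mathcal{A}\}$, viewed as a function (measure) on $\bigcup_{t\ge1}(\mathcal{H}_t\times\mathcal{A})$. For a set $X$, $\mathbf{p}_\infty^{(1)}(X)=\{\mathbf{p}_\infty^{(1)}(x):x\in X\}$. *)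

(* Defs.v *)
(* Every measurableType is pointed, so the spaces below are
   pointed types: this only says that they are nonempty, which for the state and
   observation spaces already follows from the existence of the initial law, and
   for the action spaces from the existence of a policy. *)
From HB Require Import structures.
From mathcomp Require Import all_boot all_order all_algebra.
From mathcomp Require Import all_classical all_reals all_analysis.
From mathcomp Require Import measurable_realfun.

Set Implicit Arguments.
Unset Strict Implicit.
Unset Printing Implicit Defensive.
Import Order.TTheory GRing.Theory Num.Theory.
Import numFieldNormedType.Exports.

Local Open Scope classical_set_scope.
Local Open Scope ring_scope.
Local Open Scope ereal_scope.

#[short(type="pointedCountType")]
HB.structure Definition PointedCountable := {T of Pointed T & Countable T}.
#[short(type="pointedFinType")]
HB.structure Definition PointedFinite := {T of Pointed T & Finite T}.

HB.instance Definition _ (I : finType) (T : I -> pointedType) :=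
  isPointed.Build {dffun forall i, T i} [ffun i => (point : T i)].
HB.instance Definition _ (I : finType) (T : I -> pointedCountType) :=
  Countable.on {dffun forall i, T i}.
HB.instance Definition _ (I : finType) (T : I -> pointedFinType) :=
  Finite.on {dffun forall i, T i}.
HB.instance Definition _ (T U : pointedCountType) := Countable.on (T * U)%type.

Notation borel T := (g_sigma_algebraType (@open T)).

(* An alias of the library's discrete_topology, for which the join of the pointed
   and of the topological structures is inferred. *)
Definition discrete (T : Type) : Type := discrete_topology T.
HB.instance Definition _ (T : pointedType) := Pointed.copy (discrete T) T.
HB.instance Definition _ (T : pointedType) :=
  DiscreteTopology.copy (discrete T) (discrete_topology T).

Lemma sum_dffun_prod (R : comPzSemiRingType) (I : finType) (T : I -> finType)
    (F : forall i, T i -> R) :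
  (\sum_(a : {dffun forall i, T i}) \prod_i F i (a i) =
   \prod_i \sum_(x : T i) F i x)%R.
Proof.
pose G i : {ffun T i -> R} := [ffun x => F i x].
rewrite (reindex _ (onW_bij _ (dffun_of_fprod_bij T))) /=.
transitivity (\sum_(f : fprod T) \prod_(i in I) G i (f i))%R.
  by apply: eq_bigr => f _; apply: eq_bigr => i _; rewrite !ffunE.
rewrite big_fprod.
transitivity (\prod_i \sum_(j in tagged_with T i) untag 0 (G i) j)%R.
  by rewrite bigA_distr_big_dep.
apply: eq_bigr => i _.
by rewrite -(big_tag G); apply: eq_bigr => x _; rewrite ffunE.
Qed.

Lemma measurable_discrete_tuple (T : pointedCountType) d (X : measurableType d) k
  (f : X -> T) (v : k.-tuple T) :
  (forall x : T, measurable (f @^-1` [set x])) ->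
  measurable [set w : k.-tuple X | map_tuple f w = v].
Proof.
move=> mf.
have -> : [set w : k.-tuple X | map_tuple f w = v] =
   \bigcap_(i in [set: 'I_k]) ((@tnth _ X ^~ i) @^-1` (f @^-1` [set tnth v i])).
  apply/seteqP; split => [w /= <- i _ /=|w H /=]; first by rewrite tnth_map.
  by apply: eq_from_tnth => i; rewrite tnth_map; exact: H.
apply: fin_bigcap_measurable => // i _.
by rewrite -[X in measurable X]setTI; apply: measurable_tnth.
Qed.

Lemma measurable_countable_factor (T : countType) d (X : measurableType d)
  d' (Y : measurableType d') (f : X -> T) (g : T -> Y) :
  (forall x : T, measurable (f @^-1` [set x])) -> measurable_fun setT (g \o f).
Proof.
move=> mf _ B mB; rewrite setTI.
have -> : (g \o f) @^-1` B = \bigcup_(x in g @^-1` B) (f @^-1` [set x]).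
  apply/seteqP; split => [w Bw|w [x Bx fx]]; last by rewrite /= fx.
  by exists (f w).
rewrite bigcup_mkcond; apply: countable_bigcupT_measurable => [|x].
  exact: countableP.
by case: ifPn.
Qed.

Lemma measurable_rcons k d (X : measurableType d) d' (Y : measurableType d')
   (f : X -> k.-tuple Y) (g : X -> Y) :
  measurable_fun setT f -> measurable_fun setT g ->
  measurable_fun setT (fun x => [tuple of rcons (f x) (g x)] : k.+1.-tuple Y).
Proof.
move=> mf mg; apply/measurable_fun_tnthP => i.
have [ik|ki] := ltnP i k.
  rewrite (_ : _ \o _ = (@tnth _ Y ^~ (Ordinal ik)) \o f).
    by apply: measurableT_comp => //; exact: measurable_tnth.
  apply/funext => x /=; rewrite (tnth_nth (g x)) /= nth_rcons size_tuple ik.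
  by rewrite (tnth_nth (g x)).
rewrite (_ : _ \o _ = g)//.
apply/funext => x /=; rewrite (tnth_nth (g x)) /= nth_rcons size_tuple ltnNge ki /=.
by rewrite eqn_leq ki -ltnS ltn_ord.
Qed.

Lemma measurable_discrete (T : pointedType) (A : set (borel (discrete T))) :
  measurable A.
Proof. by apply: sub_sigma_algebra; exact: discrete_open. Qed.

(* Borel probability measures with the topology of weak convergence: the coarsest
   one making m |-> \int f dm continuous for all bounded continuous f. *)
Section M1.
Variables (R : realType) (Y : ptopologicalType).

Definition M1 : Type := probability (borel Y) R.

Definition bounded_continuous : Type :=
  {f : Y -> R | continuous f /\ bounded_fun f}.

Definition expectations (m : M1) : prod_topology (fun _ : bounded_continuous => R)
  := fun f => (\int[m]_y (sval f y))%R.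

HB.instance Definition _ := Pointed.on M1.
HB.instance Definition _ := Topological.copy M1 (initial_topology expectations).

End M1.

HB.instance Definition _ (I : Type) (T : I -> ptopologicalType) :=
  Pointed.copy (prod_topology T) (forall i, T i).

(* Time is counted from 0: index t stands for the time t + 1 of the model, so that
   there are t + 1 observations and t actions in a history. *)
Section Model.
Variables (R : realType) (N : nat) (S : ptopologicalType).
Variables (O0 : pointedCountType) (Op : 'I_N -> pointedCountType).
Variable Ac : 'I_N -> pointedFinType.

Definition obs : pointedCountType := (O0 * {dffun forall n, Op n})%type.
Definition act : pointedFinType := {dffun forall n, Ac n}.

Definition history (t : nat) : Type := (t.+1.-tuple obs * t.-tuple act)%type.
Definition information (n : 'I_N) (t : nat) : Type :=
  (t.+1.-tuple O0 * (t.+1.-tuple (Op n) * t.-tuple (Ac n)))%type.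

(* What agent n knows of the joint history: common and own observations, own
   actions. *)
Definition view (n : 'I_N) (t : nat) (h : history t) : information n t :=
  ([tuple of map (fun o : obs => o.1) h.1],
    ([tuple of map (fun o : obs => o.2 n) h.1],
     [tuple of map (fun a : act => a n) h.2])).

Definition policy (n : 'I_N) : ptopologicalType :=
  prod_topology (fun t : nat =>
    prod_topology (fun _ : information n t => M1 R (discrete (Ac n)))).
Definition profile : ptopologicalType := prod_topology policy.

Definition pure_policy (n : 'I_N) : set (policy n) :=
  [set v : policy n | forall t i, exists a : Ac n,
    v t i = \d_(a : borel (discrete (Ac n))) :> (set _ -> \bar R)].
Definition pure_profile : set profile :=
  [set u | forall n, pure_policy (u n)].

Lemma pure_profile_point :
  pure_profile (fun n t i => dirac (point : borel (discrete (Ac n)))).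
Proof. by move=> n t i; exists point. Qed.

HB.instance Definition _ := isPointed.Build (set_type pure_profile)
  (SigSub (mem_set pure_profile_point)).

(* (s, o, a) at one time. *)
Definition step : measurableType _ :=
  (borel S * borel (discrete obs) * borel (discrete act))%type.

Variable P1 : probability (borel S * borel (discrete obs))%type R.
Variable P : R.-pker (borel S * borel (discrete act))%type
                  ~> (borel S * borel (discrete obs))%type.

(* The joint history when the past steps are w and the new observation is o. *)
Definition history_at (t : nat) (w : t.-tuple step) (o : obs) : history t :=
  ([tuple of rcons (map (fun x : step => x.1.2 : obs) w) o],
   [tuple of map (fun x : step => x.2 : act) w]).

(* Conditional law of the next (state, observation) given the past steps; the first
   one is drawn from P1. *)
Definition transition (t : nat) : t.-tuple step ->
    {measure set (borel S * borel (discrete obs)) -> \bar R} :=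
  match t with
  | 0 => fun=> P1
  | t'.+1 => fun w => P ((tnth w ord_max).1.1, (tnth w ord_max).2)
  end.

Section law.
Variable u : profile.

(* Decentralization: given the joint history, the agents draw their actions
   independently, each from its own information. *)
Definition action_prob (t : nat) (h : history t) (a : act) : R :=
  \prod_(n < N) fine (@u n t (view n h) [set a n]).

(* The Ionescu-Tulcea recursion: w has law mu, then x = (s, o), then a. *)
Definition next_law (t : nat) (mu : probability (t.-tuple step) R)
    (E : set (t.+1.-tuple step)) : \bar R :=
  \int[mu]_w \int[transition w]_x
    \sum_(a : act) (action_prob (history_at w x.2) a)%:E *
      \d_([tuple of rcons w (x, a)] : t.+1.-tuple step) E.

Lemma measurable_transition t (U : set (borel S * borel (discrete obs))) :
  measurable U -> measurable_fun [set: t.-tuple step] (@transition t ^~ U).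
Proof.
case: t => [|t] mU /=; first exact: measurable_cst.
apply: (measurableT_comp (measurable_kernel P U mU)) => /=.
have mt : measurable_fun setT (fun w : t.+1.-tuple step => tnth w ord_max).
  exact: measurable_tnth.
apply/measurable_fun_pairP; split => /=.
  exact: (measurableT_comp measurable_fst (measurableT_comp measurable_fst mt)).
exact: (measurableT_comp measurable_snd mt).
Qed.

HB.instance Definition _ t := isKernel.Build _ _ _ _ R (@transition t) (@measurable_transition t).

Lemma transition_setT t w : @transition t w setT = 1.
Proof. by case: t w => [|t] w /=; [exact: probability_setT | exact: prob_kernel]. Qed.

HB.instance Definition _ t :=
  Kernel_isProbability.Build _ _ _ _ R (@transition t) (@transition_setT t).

Lemma action_prob_ge0 t (h : history t) a : (0 <= action_prob h a)%R.
Proof. by apply: prodr_ge0 => n _; rewrite fine_ge0. Qed.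

Lemma sum_action_prob t (h : history t) : (\sum_a action_prob h a = 1)%R.
Proof.
etransitivity.
  exact: (@sum_dffun_prod R 'I_N Ac (fun n x => fine (@u n t (view n h) [set x]))).
rewrite big1// => n _.
set m := @u n t _.
have mA (A : set (borel (discrete (Ac n)))) : measurable A.
  exact: measurable_discrete.
apply: EFin_inj; rewrite -sumEFin -(probability_setT m).
have -> : [set: borel (discrete (Ac n))] =
    \bigcup_(x in [set: Ac n]) ([set x] : set (borel (discrete (Ac n)))).
  by apply/seteqP; split => // x _; exists x.
rewrite (@measure_fin_bigcup _ _ _ m (Ac n)) //; last first.
- by move=> x y _ _ [z [/= -> ->]].
- exact: finite_finset.
rewrite (fsbigE (index_enum (Ac n))) //.
- apply: eq_big => [x|x _]; first exact/esym/mem_set.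
  by rewrite fineK//; apply: fin_num_measure; exact: mA.
- exact: index_enum_uniq.
- by move=> x _; rewrite mem_index_enum.
Qed.

Lemma measurable_action_prob t a :
  measurable_fun setT (fun z : t.-tuple step * (borel S * borel (discrete obs)) =>
    action_prob (history_at z.1 z.2.2) a).
Proof.
pose f (z : t.-tuple step * (borel S * borel (discrete obs))) :
  t.-tuple obs * (obs * t.-tuple act) :=
  (map_tuple (fun x : step => x.1.2 : obs) z.1, (z.2.2 : obs,
   map_tuple (fun x : step => x.2 : act) z.1)).
pose g (y : t.-tuple obs * (obs * t.-tuple act)) : R :=
  action_prob ([tuple of rcons y.1 y.2.1], y.2.2) a.
rewrite (_ : (fun _ => _) = g \o f)//.
apply: measurable_countable_factor => -[v [ o b]].
have -> : f @^-1` [set (v, (o, b))] =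
    (fst @^-1` [set w : t.-tuple step | map_tuple (fun x : step => x.1.2 : obs) w = v])
    `&` (fst @^-1` [set w : t.-tuple step | map_tuple (fun x : step => x.2 : act) w = b])
    `&` (snd @^-1` (snd @^-1` [set o])).
  apply/seteqP; split => z /=; [by case=> <- <- <-|by case=> -[<- <-] <-].
have mfst (A : set (t.-tuple step)) : measurable A ->
    measurable (fst @^-1` A :
      set (t.-tuple step * (borel S * borel (discrete obs)))).
  by move=> mA; rewrite -[X in measurable X]setTI; exact: measurable_fst.
apply: measurableI; [apply: measurableI; apply: mfst|].
- apply: measurable_discrete_tuple => x.
  rewrite -[X in measurable X]setTI.
  apply: (measurableT_comp measurable_snd measurable_fst) => //.
  exact: measurable_discrete.
- apply: measurable_discrete_tuple => x.
  rewrite -[X in measurable X]setTI.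
  by apply: measurable_snd => //; exact: measurable_discrete.
- rewrite -[X in measurable X]setTI.
  apply: (measurableT_comp measurable_snd measurable_snd) => //.
  exact: measurable_discrete.
Qed.

Let integrand t E (z : t.-tuple step * (borel S * borel (discrete obs))) : \bar R :=
  \sum_(a : act) (action_prob (history_at z.1 z.2.2) a)%:E *
      \d_([tuple of rcons z.1 (z.2, a)] : t.+1.-tuple step) E.

Let integrand_ge0 t E z : 0 <= @integrand t E z.
Proof.
by apply: sume_ge0 => a _; rewrite mule_ge0// lee_fin action_prob_ge0.
Qed.

Let measurable_integrand t E : measurable E -> measurable_fun setT (@integrand t E).
Proof.
move=> mE; apply: emeasurable_sum => a; apply: emeasurable_funM.
  by apply/measurable_EFinP; exact: measurable_action_prob.
apply: (@measurableT_comp _ _ _ _ _ _ (fun y : t.+1.-tuple step => \d_y E)).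
  exact: measurable_fun_dirac.
apply: measurable_rcons => //.
apply/measurable_fun_pairP; split; first exact: measurable_snd.
exact: (@measurable_cst _ _ _ _ _ (a : borel (discrete act))).
Qed.

Let inner t E (w : t.-tuple step) : \bar R := \int[transition w]_x @integrand t E (w, x).

Let inner_ge0 t E w : 0 <= @inner t E w.
Proof. by apply: integral_ge0 => x _; exact: integrand_ge0. Qed.

Let measurable_inner t E : measurable E -> measurable_fun setT (@inner t E).
Proof.
move=> mE.
apply: (@measurable_fun_integral_finite_kernel _ _ _ _ _ (@integrand t E) (@transition t)).
  exact: integrand_ge0.
exact: measurable_integrand.
Qed.

Section next_law_measure.
Variables (t : nat) (mu : probability (t.-tuple step) R).

Let next_law0 : next_law mu set0 = 0.
Proof.
rewrite /next_law integral0_eq// => w _; rewrite integral0_eq// => x _.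
by rewrite big1// => a _; rewrite measure0 mule0.
Qed.

Let next_law_ge0 E : 0 <= next_law mu E.
Proof.
by apply: integral_ge0 => w _; exact: inner_ge0.
Qed.

Let next_law_sigma_additive : semi_sigma_additive (next_law mu).
Proof.
move=> F mF tF mUF.
have -> : next_law mu (\bigcup_n F n) = \sum_(n <oo) next_law mu (F n).
  have intE z : @integrand t (\bigcup_n F n) z = \sum_(n <oo) @integrand t (F n) z.
    rewrite /integrand nneseries_sum; last first.
      by move=> a n _; rewrite mule_ge0// lee_fin action_prob_ge0.
    apply: eq_bigr => a _; rewrite nneseriesZl; last by move=> n _.
    congr (_ * _); rewrite measure_bigcup//.
    by apply: eq_eseriesl => n; exact/mem_set.
  have innE w : @inner t (\bigcup_n F n) w = \sum_(n <oo) @inner t (F n) w.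
    rewrite /inner -integral_nneseries//; first by apply: eq_integral.
    by move=> n; apply: measurable_fun_pair2; exact: measurable_integrand.
  rewrite -[LHS]/(\int[mu]_w inner _ w).
  under eq_integral do rewrite innE.
  by rewrite integral_nneseries// => n; exact: measurable_inner.
by apply: is_cvg_nneseries => n _ _; exact: next_law_ge0.
Qed.

HB.instance Definition _ := isMeasure.Build _ _ _ (next_law mu)
  next_law0 next_law_ge0 next_law_sigma_additive.

Let next_law_setT : next_law mu setT = 1.
Proof.
rewrite /next_law (eq_integral (cst 1)).
  by rewrite integral_cst// mul1e; exact: probability_setT.
move=> w _; rewrite (eq_integral (cst 1)).
  by rewrite integral_cst// mul1e; exact: transition_setT.
move=> x _; under eq_bigr do rewrite diracT mule1.
by rewrite sumEFin sum_action_prob.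
Qed.

HB.instance Definition _ :=
  Measure_isProbability.Build _ _ _ (next_law mu) next_law_setT.

End next_law_measure.

(* The law of the first t steps (S, O, A) under u; only these finite-horizon
   marginals of the law of the whole process enter the occupation measures. *)
Fixpoint law (t : nat) : probability (t.-tuple step) R :=
  match t with
  | 0 => dirac ([tuple] : 0.-tuple step)
  | t'.+1 => next_law (law t')
  end.

(* The probability of (h_t, a_t) under u. *)
Definition occupation (i : {t : nat & (history t * act)%type}) : \bar R :=
  let: existT t (h, a) := i in
  law t.+1 [set w : t.+1.-tuple step | map_tuple (fun x : step => x.1.2 : obs) w = h.1 /\
                  map_tuple (fun x : step => x.2 : act) w = [tuple of rcons h.2 a]].

End law.

Definition occupation_mix (mu : M1 R profile) i : \bar R :=
  \int[mu]_u occupation u i.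

Definition occupation_mix_pure (mu : M1 R (set_type pure_profile)) i : \bar R :=
  \int[mu]_u occupation (set_val u) i.

End Model.

Arguments profile R {N} O0 Op Ac.
Arguments pure_profile R {N} O0 Op Ac.

(* Main.v *)
(* Kuhn's argument, for a mixture.  The probability of a finite play factors as C * W(u), where W(u) is the product of the probabilities that the
   policies give to the actions played and C depends only on the dynamics (it is
   the probability of the play under the policies that play these actions blindly).
   The factors of W(u) are the values of u at pairwise distinct (agent, time,
   information) triples, so W has the same mean when u is replaced by the pure
   profile that draws, independently, one action for each of the countably many
   triples with the law prescribed by u.  The law of this random pure profile is
   obtained from Lebesgue measure on [0, 1[ by arithmetic coding: a word of actions
   is a subinterval whose length is the probability of the word averaged over the
   mixture. *)
Require Import Defs.
From HB Require Import structures.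
From mathcomp Require Import all_boot all_order all_algebra.
From mathcomp Require Import all_classical all_reals all_analysis.
From mathcomp Require Import measurable_realfun.
Import Order.TTheory GRing.Theory Num.Theory.
Import numFieldNormedType.Exports.
Local Open Scope classical_set_scope.
Local Open Scope ring_scope.

Set Implicit Arguments.
Unset Strict Implicit.
Unset Printing Implicit Defensive.

(** * Locating a point among consecutive half-open intervals *)

Section cumulative_sums.
Variables (R : realDomainType) (c : nat -> R).
Hypothesis c_ge0 : forall j, 0 <= c j.

Lemma cumulative_le m n : (m <= n)%N -> \sum_(i < m) c i <= \sum_(i < n) c i.
Proof.
move=> mn; rewrite -!(big_mkord xpredT c) [leRHS](@big_cat_nat _ _ _ m)//= lerDl.
exact: sumr_ge0.
Qed.

Lemma cumulative_find n v : 0 <= v -> v < \sum_(i < n) c i ->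
  exists2 j, (j < n)%N & \sum_(i < j) c i <= v < \sum_(i < j) c i + c j.
Proof.
elim: n => [|n IH] v0; first by rewrite big_ord0 ltNge v0.
rewrite big_ord_recr /= => vn; have [/(IH v0)[j jn Hj]|nv] := ltP v (\sum_(i < n) c i).
  by exists j => //; exact: ltnW.
by exists n => //; rewrite nv.
Qed.

Lemma cumulative_inj j k v :
  \sum_(i < j) c i <= v < \sum_(i < j) c i + c j ->
  \sum_(i < k) c i <= v < \sum_(i < k) c i + c k -> j = k.
Proof.
wlog jk : j k / (j <= k)%N => [H|].
  by case: (leqP j k) => [|/ltnW] jk Hj Hk; [exact: H|exact/esym/H].
move=> /andP[_ vj] /andP[kv _]; apply/eqP; rewrite eqn_leq jk /= leqNgt.
apply/negP => /cumulative_le; rewrite big_ord_recr /= => /(lt_le_trans vj).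
by rewrite ltNge kv.
Qed.

End cumulative_sums.

(** * Random sequences coded by Lebesgue measure *)

(* Words list the most recent letter first; [Q s] is the probability that the
   sequence starts with [rev s]. *)
Section arithmetic_coding.
Variables (R : realType) (T : finType) (x0 : T) (Q : seq T -> R).
Hypothesis Q_nil : Q [::] = 1.
Hypothesis Q_ge0 : forall s, 0 <= Q s.
Hypothesis Q_cons : forall s, Q s = \sum_x Q (x :: s).

Let letter := nth x0 (enum T).

(** The intervals of the words [x :: s'] are laid side by side inside that of [s'], in the order of
    [enum T]. *)
Fixpoint cell_left (s : seq T) : R :=
  if s is x :: s' then
    cell_left s' + \sum_(j < index x (enum T)) Q (letter j :: s')
  else 0.

Definition cell (s : seq T) (w : R) : bool :=
  cell_left s <= w < cell_left s + Q s.

(** The default [x0] is reached only when [w] lies outside the cell of [s]. *)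
Definition decode_next (w : R) (s : seq T) : T :=
  odflt x0 [pick x | cell (x :: s) w].

Fixpoint decode (w : R) (k : nat) : seq T :=
  if k is k'.+1 then decode_next w (decode w k') :: decode w k' else [::].

Definition coded_letter (k : nat) (w : R) : T := decode_next w (decode w k).

Let letter_index x : letter (index x (enum T)) = x.
Proof. by rewrite /letter nth_index// mem_enum. Qed.

Let cell_consE x s w : cell (x :: s) w =
  let c j := Q (letter j :: s) in
  (\sum_(j < index x (enum T)) c j <= w - cell_left s
    < \sum_(j < index x (enum T)) c j + c (index x (enum T))).
Proof.
by rewrite /cell /= letter_index lerBrDl ltrBlDl addrA.
Qed.

Let sum_letters s : \sum_(j < size (enum T)) Q (letter j :: s) = Q s.
Proof.
by rewrite Q_cons -[RHS]big_enum [RHS](big_nth x0) big_mkord.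
Qed.

Lemma cell_cons_inj s w x y : cell (x :: s) w -> cell (y :: s) w -> x = y.
Proof.
rewrite !cell_consE /= => Hx Hy.
have := @cumulative_inj R (fun j => Q (letter j :: s)) (fun=> Q_ge0 _) _ _ _ Hx Hy.
by move=> /(congr1 letter); rewrite !letter_index.
Qed.

Lemma sub_cell x s w : cell (x :: s) w -> cell s w.
Proof.
rewrite cell_consE /= => /andP[H1 H2]; rewrite /cell -[_ + Q s]addrC -ltrBlDr.
rewrite -subr_ge0; apply/andP; split.
  by apply: le_trans H1; exact: sumr_ge0.
apply: lt_le_trans H2 _; rewrite -(sum_letters s).
have /(cumulative_le (c := fun j => Q (letter j :: s)) (fun=> Q_ge0 _)) :
  (index x (enum T) < size (enum T))%N by rewrite index_mem mem_enum.
by rewrite big_ord_recr.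
Qed.

(** The one-letter extensions of [s] tile its cell: by [Q_cons] their lengths add up to [Q s], so
    the search for a letter cannot fail there. *)
Lemma cell_decode_next s w : cell s w -> cell (decode_next w s :: s) w.
Proof.
move=> sw; rewrite /decode_next; case: pickP => //= H.
have [||j jn Hj] := @cumulative_find R (fun j => Q (letter j :: s))
   (size (enum T)) (w - cell_left s).
- by case/andP: sw; rewrite subr_ge0.
- by case/andP: sw => _; rewrite sum_letters ltrBlDl.
by have := H (letter j); rewrite cell_consE /= index_uniq ?enum_uniq// Hj.
Qed.

Lemma decode_cell w k : 0 <= w < 1 -> cell (decode w k) w.
Proof.
move=> w01; elim: k => [|k IH] /=; last exact: cell_decode_next.
by rewrite /cell /= add0r Q_nil.
Qed.

Lemma decodeE w s : 0 <= w < 1 -> (decode w (size s) == s) = cell s w.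
Proof.
move=> w01; apply/eqP/idP => [<-|]; first exact: decode_cell.
elim: s => [//|x s IH] xs /=; have sw := sub_cell xs.
by rewrite (IH sw); congr (_ :: _); apply: cell_cons_inj (cell_decode_next sw) xs.
Qed.

Lemma cellE s : [set w | cell s w] = `[cell_left s, cell_left s + Q s[%classic.
Proof. by apply/seteqP; split => w; rewrite /= in_itv. Qed.

(** Cells are nested and that of the empty word is [[0, 1[], so every cell lies in the unit
    interval. *)
Lemma decode_unit_interval s :
  [set w | decode w (size s) = s] `&` `[0, 1[ = [set w | cell s w].
Proof.
apply/seteqP; split => w /=; rewrite in_itv /=.
  by move=> [/eqP + w01]; rewrite decodeE.
move=> sw; suff w01 : 0 <= w < 1 by split=> //; apply/eqP; rewrite decodeE.
have {sw} : cell [::] w by elim: s sw => // x s IH /sub_cell.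
by rewrite /cell /= add0r Q_nil.
Qed.

End arithmetic_coding.

Section unit_interval.
Variable R : realType.

Definition unit_interval : set (measurableTypeR R) := `[0, 1[%classic.

Lemma measurable_unit_interval : measurable unit_interval.
Proof. exact: measurable_itv. Qed.

Definition unit_lebesgue : set (measurableTypeR R) -> \bar R :=
  mrestr (@lebesgue_measure R) measurable_unit_interval.

HB.instance Definition _ := Measure.on unit_lebesgue.

Lemma unit_lebesgueT : unit_lebesgue setT = 1%E.
Proof.
rewrite /unit_lebesgue /mrestr setTI [LHS]lebesgue_measure_itv /= lte_fin ltr01.
by rewrite -EFinD subr0.
Qed.

HB.instance Definition _ :=
  Measure_isProbability.Build _ _ _ unit_lebesgue unit_lebesgueT.

End unit_interval.

Section past.
Variable T : Type.
Implicit Type Z : nat -> T.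

(** Reversed to match the coding words, whose head is the most recent letter. *)
Definition past Z k : seq T := rev (mkseq Z k).

Lemma pastS Z k : past Z k.+1 = Z k :: past Z k.
Proof. by rewrite /past mkseqS rev_rcons. Qed.

Lemma size_past Z k : size (past Z k) = k.
Proof. by rewrite size_rev size_mkseq. Qed.

Lemma past_eq Z Z' k j : past Z' k = past Z k -> (j < k)%N -> Z' j = Z j.
Proof.
move=> /(congr1 rev); rewrite !revK => e jk.
by rewrite -[LHS](nth_mkseq (Z 0%N) Z' jk) e nth_mkseq.
Qed.

Lemma eq_past Z Z' k : (forall j, (j < k)%N -> Z' j = Z j) -> past Z' k = past Z k.
Proof.
by elim: k => // k IH ZZ; rewrite !pastS ZZ// IH// => j jk; apply/ZZ/ltnW.
Qed.

End past.

Section coded_process.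
Variables (R : realType) (T : finType) (x0 : T) (Q : seq T -> R).
Hypothesis Q_nil : Q [::] = 1.
Hypothesis Q_ge0 : forall s, 0 <= Q s.
Hypothesis Q_cons : forall s, Q s = \sum_x Q (x :: s).

(** Points outside [[0, 1[] are null for [unit_lebesgue]; giving them a constant value makes
    measurability on the whole line easy. *)
Definition coded_process (w : R) (k : nat) : T :=
  if 0 <= w < 1 then coded_letter x0 Q k w else x0.

Lemma past_coded w k : 0 <= w < 1 -> past (coded_process w) k = decode x0 Q w k.
Proof.
move=> w01; elim: k => // k IH.
by rewrite pastS IH /= /coded_process w01.
Qed.

Lemma past_coded_unit s :
  [set w : measurableTypeR R | past (coded_process w) (size s) = s] `&` @unit_interval R =
  `[cell_left x0 Q s, cell_left x0 Q s + Q s[%classic.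
Proof.
rewrite -cellE -decode_unit_interval//.
by apply/seteqP; split => w /= [+ w01]; move: (w01); rewrite /= in_itv /= => ?;
  rewrite past_coded.
Qed.

(** Inside [[0, 1[] the event is an interval; outside, the past is constant, so the event there is
    everything or empty. *)
Lemma measurable_past_coded s :
  measurable [set w : measurableTypeR R | past (coded_process w) (size s) = s].
Proof.
rewrite -[X in measurable X](setUIDK _ (@unit_interval R)) past_coded_unit.
apply: measurableU; first exact: measurable_itv.
have mI := measurableC (@measurable_unit_interval R).
have past_out (w : measurableTypeR R) :
    ~ unit_interval w -> past (coded_process w) (size s) = past (fun=> x0) (size s).
  move=> w01; congr (rev _); apply: eq_mkseq => k.
  by rewrite /coded_process ifN//; apply/negP; move: w01; rewrite /unit_interval /= in_itv.
have [e|e] := pselect (past (fun=> x0) (size s) = s).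
  rewrite (_ : _ `\` _ = ~` @unit_interval R)//.
  by apply/seteqP; split => w; [case|move=> Hw; split=> //=; rewrite past_out].
rewrite (_ : _ `\` _ = set0)//.
by apply/seteqP; split => // w [/= + Hw]; rewrite past_out.
Qed.

Lemma unit_lebesgue_past s :
  @unit_lebesgue R [set w | past (coded_process w) (size s) = s] = (Q s)%:E.
Proof.
rewrite /unit_lebesgue /mrestr past_coded_unit [LHS]lebesgue_measure_itv /=.
rewrite lte_fin ltrDl -EFinD addrAC subrr add0r lt0r Q_ge0 andbT.
(* A word with [Q s = 0] has an empty interval, of measure 0. *)
by case: eqP => // ->.
Qed.

End coded_process.

(** * Mixtures of product laws and their coding *)

Section mixture.
Variables (R : realType) (d : measure_display) (Y : measurableType d).
Variables (mu : probability Y R) (T : finType) (x0 : T) (q : nat -> Y -> T -> R).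
Hypothesis mq : forall k x, measurable_fun setT (q k ^~ x).
Hypothesis q_ge0 : forall k y x, 0 <= q k y x.
Hypothesis sum_q : forall k y, \sum_x q k y x = 1.

(** Probability of the word under the product law of parameter [y]; the head is the latest letter,
    hence drawn with the law of index [size s']. *)
Fixpoint weight (s : seq T) (y : Y) : R :=
  if s is x :: s' then q (size s') y x * weight s' y else 1.

Lemma weight_ge0 s y : 0 <= weight s y.
Proof. by elim: s => //= x s IH; exact: mulr_ge0. Qed.

Lemma q_le1 k y x : q k y x <= 1.
Proof. by rewrite -(sum_q k y) (bigD1 x)//= lerDl sumr_ge0. Qed.

Lemma weight_le1 s y : weight s y <= 1.
Proof.
elim: s => //= x s IH; rewrite -[leRHS]mulr1; apply: ler_pM => //.
  exact: weight_ge0.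
exact: q_le1.
Qed.

Lemma measurable_weight s : measurable_fun setT (weight s).
Proof. by elim: s => [|x s IH] /=; [exact: measurable_cst|exact: measurable_funM]. Qed.

(** Whole words are averaged over [mu], which keeps the correlation between letters; in general this
    is not the product of the averaged laws. *)
Definition path_mass (s : seq T) : R := fine (\int[mu]_y (weight s y)%:E)%E.

Lemma path_massE s : ((path_mass s)%:E = \int[mu]_y (weight s y)%:E)%E.
Proof.
rewrite fineK// ge0_fin_numE; last first.
  by apply: integral_ge0 => y _; rewrite lee_fin weight_ge0.
apply: (@le_lt_trans _ _ (\int[mu]_y (cst 1%:E y))%E); last first.
  by rewrite integral_cst// mul1e -ge0_fin_numE//; exact: fin_num_measure.
apply: ge0_le_integral => //.
- by move=> y _; rewrite lee_fin weight_ge0.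
- by apply/measurable_EFinP; exact: measurable_weight.
- by move=> y _; rewrite lee_fin weight_le1.
Qed.

Lemma path_mass_nil : path_mass [::] = 1.
Proof.
apply: EFin_inj; rewrite path_massE -[LHS]/(\int[mu]_y (cst 1%:E y))%E.
by rewrite integral_cst// mul1e; exact: probability_setT.
Qed.

Lemma path_mass_ge0 s : 0 <= path_mass s.
Proof.
by rewrite fine_ge0// integral_ge0// => y _; rewrite lee_fin weight_ge0.
Qed.

Lemma path_mass_cons s : path_mass s = \sum_x path_mass (x :: s).
Proof.
apply: EFin_inj; rewrite path_massE -sumEFin.
under [RHS]eq_bigr do rewrite path_massE.
rewrite -ge0_integral_sum//.
- apply: eq_integral => y _; rewrite sumEFin /= -big_distrl/=.
  by rewrite sum_q mul1r.
- by move=> x; apply/measurable_EFinP; exact: measurable_weight.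
- by move=> x y _; rewrite lee_fin weight_ge0.
Qed.

Definition mixture_process : R -> nat -> T := coded_process x0 path_mass.

Lemma measurable_past_mixture s :
  measurable [set w : measurableTypeR R | past (mixture_process w) (size s) = s].
Proof.
exact: (measurable_past_coded x0 path_mass_nil path_mass_ge0 path_mass_cons).
Qed.

(** Induction on the number [m] of constrained letters still to be drawn, for every prefix [s]
    already fixed; for [m = 0] the event is a cylinder, of measure [path_mass s]. *)
Lemma mixture_process_from (A : nat -> pred T) m s :
  let E := [set w : measurableTypeR R |
    past (mixture_process w) (size s) = s /\
    forall k, (size s <= k < size s + m)%N -> A k (mixture_process w k)] in
  measurable E /\
  (unit_lebesgue E = \int[mu]_y
    (weight s y * \prod_(size s <= k < size s + m) \sum_(x | A k x) q k y x)%:E)%E.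
Proof.
elim: m s => [|m IH] s /=.
  rewrite (_ : [set _ | _] = [set w | past (mixture_process w) (size s) = s]).
    split; first exact: measurable_past_mixture.
    rewrite (unit_lebesgue_past x0 path_mass_nil path_mass_ge0 path_mass_cons).
    rewrite path_massE; apply: eq_integral => y _.
    by rewrite big_geq ?addn0// mulr1.
  apply/seteqP; split => w /=; first by case.
  by move=> ->; split=> // k; rewrite addn0; case: ltngtP.
pose E x := [set w : measurableTypeR R |
    past (mixture_process w) (size (x :: s)) = x :: s /\
    forall k, (size (x :: s) <= k < size (x :: s) + m)%N -> A k (mixture_process w k)].
(* Splitting on the letter of index [size s] gives disjoint events, covered by the induction
   hypothesis for the prefixes [x :: s]. *)
rewrite (_ : [set _ | _] = \bigcup_(x in [set x | A (size s) x]) E x); last first.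
  apply/seteqP; split => w /=.
    move=> [ws wA]; exists (mixture_process w (size s)).
      by apply: wA; rewrite leqnn -[ltnLHS]addn0 ltn_add2l.
    split; first by rewrite pastS ws.
    by move=> k /= /andP[sk km]; apply: wA; rewrite ltnW//= addnS -addSn.
  move=> [x xA []]; rewrite pastS => -[wx ws] wA; split=> // k.
  rewrite leq_eqVlt => /andP[/predU1P[<- _|sk km]]; first by rewrite wx.
  by apply: wA; rewrite /= sk addSnnS.
have finA : finite_set [set x | A (size s) x] by exact: finite_finset.
split; first by apply: fin_bigcup_measurable => // x _; exact: (IH (x :: s)).1.
rewrite measure_fin_bigcup//=; last 2 first.
- by move=> x y _ _ [w [[/= wx _] [/= wy _]]]; move: wx; rewrite wy => -[].
- by move=> x _; exact: (IH (x :: s)).1.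
have -> : [set x | A (size s) x] = [set` [seq x <- index_enum T | A (size s) x]].
  by apply/seteqP; split => x /=; rewrite mem_filter mem_index_enum andbT.
rewrite -fsbig_seq ?filter_uniq ?index_enum_uniq//=.
under eq_bigr do rewrite (IH (_ :: s)).2.
rewrite -ge0_integral_sum//; last 2 first.
- move=> x; apply/measurable_EFinP; apply: measurable_funM; first exact: measurable_weight.
  apply: measurable_prod => k _; under eq_fun do rewrite -big_filter.
  by apply: measurable_sum => z; exact: mq.
- move=> x y _; rewrite lee_fin mulr_ge0 ?weight_ge0// prodr_ge0// => k _.
  by rewrite sumr_ge0.
apply: eq_integral => y _; rewrite big_filter sumEFin; congr (_%:E).
have sm : (size s < size s + m.+1)%N by rewrite -addSnnS leq_addr.
(* Summing [q (size s) y x] over the allowed [x] restores the first factor of the product. *)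
rewrite /= [in RHS](big_ltn sm) addSnnS.
by rewrite -!big_distrl /= -mulrA mulrCA.
Qed.

Lemma mixture_process_unit (A : nat -> pred T) K :
  let E := [set w : measurableTypeR R |
    forall k, (k < K)%N -> A k (mixture_process w k)] in
  measurable E /\
  (unit_lebesgue E = \int[mu]_y (\prod_(k < K) \sum_(x | A k x) q k y x)%:E)%E.
Proof.
move=> E; have := mixture_process_from A K [::].
rewrite /= add0n (_ : [set _ | _] = E) => [[mE ->]|].
  by split=> //; apply: eq_integral => y _; rewrite mul1r big_mkord.
by apply/seteqP; split => w /=; [case|].
Qed.

End mixture.

(** * The play probabilities factor through the policies *)

Section factorization.
Variables (R : realType) (N : nat) (S : ptopologicalType).
Variables (O0 : pointedCountType) (Op : 'I_N -> pointedCountType).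
Variable Ac : 'I_N -> pointedFinType.
Variable P1 : probability (borel S * borel (discrete (obs O0 Op)))%type R.
Variable P : R.-pker (borel S * borel (discrete (act Ac)))%type
           ~> (borel S * borel (discrete (obs O0 Op)))%type.

Local Notation step := (step S O0 Op Ac).
Local Notation profile := (profile R O0 Op Ac).
Local Open Scope ereal_scope.

Variables (o : nat -> obs O0 Op) (b : nat -> act Ac).

Definition scripted_event t : set (t.-tuple step) :=
  [set w | forall i : 'I_t, ((tnth w i).1.2 = o i) /\ ((tnth w i).2 = b i)].
Arguments scripted_event : clear implicits.

Definition scripted_history t : history O0 Op Ac t :=
  ([tuple o i | i < t.+1], [tuple b i | i < t]).

(** Along the script its action probabilities are 1, so there its law records the dynamics alone. *)
Definition scripted_profile : profile :=
  fun n t _ => dirac (b t n : borel (discrete (Ac n))).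

Definition scripted_prob (u : profile) t : R :=
  (\prod_(s < t) action_prob u (scripted_history s) (b s))%R.

Lemma scripted_prob_ge0 u t : (0 <= scripted_prob u t)%R.
Proof. by apply: prodr_ge0 => s _; exact: action_prob_ge0. Qed.

Lemma action_prob_scripted t :
  action_prob scripted_profile (scripted_history t) (b t) = 1%R.
Proof.
rewrite /action_prob big1// => n _.
by rewrite [X in fine X](@diracE _ (borel (discrete (Ac n)))) mem_set.
Qed.

Lemma measurable_scripted_event t : measurable (scripted_event t).
Proof.
have -> : scripted_event t = \bigcap_(i in [set: 'I_t])
    ((@tnth _ step ^~ i) @^-1` [set x : step | x.1.2 = o i /\ x.2 = b i]).
  by apply/seteqP; split => [w H i _|w H i]; apply: H.
apply: fin_bigcap_measurable => // i _.
rewrite -[X in measurable X]setTI; apply: measurable_tnth => //.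
have -> : [set x : step | x.1.2 = o i /\ x.2 = b i] =
   ([set: step] `&` (snd \o fst) @^-1` [set o i]) `&`
   ([set: step] `&` snd @^-1` [set b i]) .
  by apply/seteqP; split => x /= [] => [? ?|[_ ?] [_ ?]].
apply: measurableI.
  apply: (measurableT_comp measurable_snd measurable_fst) => //.
  exact: measurable_discrete.
by apply: measurable_snd => //; exact: measurable_discrete.
Qed.

Lemma scripted_event_rcons t (w : t.-tuple step) x a :
  scripted_event t.+1 [tuple of rcons w (x, a)] ->
  [/\ scripted_event t w, a = b t & history_at w x.2 = scripted_history t].
Proof.
move=> H.
have Hw (i : 'I_t) : (tnth w i).1.2 = o i /\ (tnth w i).2 = b i.
  have := H (widen_ord (leqnSn t) i).
  by rewrite !(tnth_nth (x, a)) /= nth_rcons size_tuple ltn_ord.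
have [/= Hx Ha] : x.2 = o t /\ a = b t.
  have := H ord_max; by rewrite !(tnth_nth (x, a)) /= nth_rcons size_tuple ltnn eqxx.
split=> //; rewrite /history_at /scripted_history; congr (_, _).
  apply: eq_from_tnth => i; rewrite (tnth_nth (o t)) /= nth_rcons size_map size_tuple.
  rewrite tnth_mktuple; case: ltngtP => it.
  - by rewrite (nth_map (x, a)) ?size_tuple// -(tnth_nth _ _ (Ordinal it)) (Hw _).1.
  - by have := ltn_ord i; rewrite ltnS leqNgt it.
  - by rewrite Hx it.
apply: eq_from_tnth => i; rewrite tnth_map tnth_mktuple.
exact: (Hw i).2.
Qed.

(* Inside the event of the script, the next-step kernel of u is that of the dynamics
   alone times a constant. *)
Section next_step.
Variables (t : nat) (A : set (t.+1.-tuple step)).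
Hypothesis mA : measurable A.
Hypothesis sA : A `<=` scripted_event t.+1.

Let hit (z : t.-tuple step * (borel S * borel (discrete (obs O0 Op)))) : \bar R :=
  \d_([tuple of rcons z.1 (z.2, b t)] : t.+1.-tuple step) A.

Let reach (w : t.-tuple step) : \bar R := \int[transition P1 P w]_x hit (w, x).

Let measurable_hit : measurable_fun setT hit.
Proof.
apply: (@measurableT_comp _ _ _ _ _ _ (fun y : t.+1.-tuple step => \d_y A)).
  exact: measurable_fun_dirac.
apply: measurable_rcons => //.
apply/measurable_fun_pairP; split; first exact: measurable_snd.
exact: (@measurable_cst _ _ _ _ _ (b t : borel (discrete (act Ac)))).
Qed.

Let reach_ge0 w : 0 <= reach w.
Proof. by apply: integral_ge0. Qed.

Let measurable_reach : measurable_fun setT reach.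
Proof.
by apply: (@measurable_fun_integral_finite_kernel _ _ _ _ _ hit
  (@transition _ _ _ _ _ _ P1 P t)).
Qed.

Let reach_out w : ~ scripted_event t w -> reach w = 0.
Proof.
move=> Hw; rewrite /reach integral0_eq// => x _.
by rewrite /hit diracE memNset// => /sA /scripted_event_rcons[].
Qed.

Lemma law_scriptedS : exists r : t.-tuple step -> \bar R,
  [/\ measurable_fun setT r, (forall w, 0 <= r w) &
  forall u : profile, law P1 P u t.+1 A =
    (action_prob u (scripted_history t) (b t))%:E *
    \int[law P1 P u t]_(w in scripted_event t) r w].
Proof.
(* [reach] involves only the dynamics and the prescribed action [b t], so one function serves every
   profile. *)
exists reach; split=> // u; set mu := law P1 P u t.
rewrite -[LHS]/(next_law P1 P u mu A).
transitivity (\int[mu]_w ((action_prob u (scripted_history t) (b t))%:E * reach w)).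
  apply: eq_integral => w _; rewrite -ge0_integralZl//; last 2 first.
  - by apply: measurable_fun_pair2; exact: measurable_hit.
  - by rewrite lee_fin action_prob_ge0.
  apply: eq_integral => x _.
  (* As [A] lies in the scripted event, only the action [b t] contributes, and only from the
     scripted history. *)
  rewrite (bigD1 (b t))//= big1 ?adde0 => [|a ab].
    rewrite /hit diracE /=; case: (boolP (_ \in A)) => [|_]; last by rewrite !mule0.
    by rewrite inE => /sA /scripted_event_rcons[_ _ ->].
  rewrite diracE memNset ?mule0// => /sA /scripted_event_rcons[_ e _].
  by rewrite e eqxx in ab.
rewrite ge0_integralZl//; last by rewrite lee_fin action_prob_ge0.
congr (_ * _); rewrite [RHS]integral_mkcond; apply: eq_integral => w _.
by rewrite patchE; case: ifPn => // /negP; rewrite inE => /reach_out.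
Qed.

End next_step.

(** Proportionality is claimed on all measurable parts of the event because the induction step
    compares integrals of [r] over it under the two laws. *)
Lemma law_scripted (u : profile) t (A : set (t.-tuple step)) :
  measurable A -> A `<=` scripted_event t ->
  law P1 P u t A = (scripted_prob u t)%:E * law P1 P scripted_profile t A.
Proof.
elim: t A => [|t IH] A mA sA; first by rewrite /scripted_prob big_ord0 mul1e.
have [r [mr r0 rE]] := law_scriptedS mA sA.
have rE1 := rE scripted_profile; rewrite action_prob_scripted mul1e in rE1.
pose c := NngNum (scripted_prob_ge0 u t).
have intE : \int[law P1 P u t]_(w in scripted_event t) r w =
    (scripted_prob u t)%:E * \int[law P1 P scripted_profile t]_(w in scripted_event t) r w.
  transitivity (\int[mscale c (law P1 P scripted_profile t)]_(w in scripted_event t) r w).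
    by apply: eq_measure_integral => B mB sB; exact: IH.
  apply: ge0_integral_mscale => //.
  - exact: measurable_scripted_event.
  - exact: measurable_funTS.
apply: (eq_trans (rE u)); rewrite intE rE1.
by rewrite /scripted_prob big_ord_recr /= EFinM muleA [X in X * _]muleC.
Qed.

Lemma law_scripted_event (u : profile) t :
  law P1 P u t (scripted_event t) =
  (scripted_prob u t)%:E * law P1 P scripted_profile t (scripted_event t).
Proof. by apply: law_scripted => //; exact: measurable_scripted_event. Qed.

End factorization.

Lemma occupation_scripted (R : realType) (N : nat) (S : ptopologicalType)
    (O0 : pointedCountType) (Op : 'I_N -> pointedCountType)
    (Ac : 'I_N -> pointedFinType)
    (P1 : probability (borel S * borel (discrete (obs O0 Op)))%type R)
    (P : R.-pker (borel S * borel (discrete (act Ac)))%type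
           ~> (borel S * borel (discrete (obs O0 Op)))%type) i :
  exists o b t (C : R), (0 <= C)%R /\ forall u : profile R O0 Op Ac,
    occupation P1 P u i = (C * scripted_prob o b u t)%:E.
Proof.
case: i => t [h a].
(* The finite play is extended to an infinite script; the default values occur only beyond the
   horizon [t.+1] of the event. *)
pose o := nth (point : obs O0 Op) h.1.
pose b := nth a (rcons h.2 a).
exists o, b, t.+1.
pose m u := law P1 P u t.+1 (@scripted_event N S O0 Op Ac o b t.+1).
have m_fin u : m u \is a fin_num.
  by rewrite fin_num_measure//; exact: measurable_scripted_event.
exists (fine (m (@scripted_profile R N O0 Op Ac b))); split; first exact: fine_ge0.
move=> u; rewrite mulrC EFinM fineK// -law_scripted_event /=.
congr (law P1 P u t.+1 _); apply/seteqP; split => w /=.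
  move=> [wo wb] j; rewrite /o -wo /b -[rcons _ _]/(tval [tuple of rcons h.2 a]) -wb.
  by rewrite -!tnth_nth !tnth_map.
move=> H; split; apply: eq_from_tnth => j; rewrite tnth_map.
  by rewrite (H j).1 (tnth_nth point).
by rewrite (H j).2 (tnth_nth a).
Qed.

(** * Borel measurability *)

Section borel_measurability.
Variable X : ptopologicalType.

Lemma continuous_borel_measurable (Y : ptopologicalType) (f : X -> Y) :
  continuous f -> measurable_fun setT (f : borel X -> borel Y).
Proof.
move=> /continuousP cf; apply: (@measurability _ _ (borel X) (borel Y) _ _ open) => //.
by move=> _ [B oB <-]; rewrite setTI; apply: sub_sigma_algebra; exact: cf.
Qed.

Lemma continuous_real_measurable (R : realType) (f : X -> R) :
  continuous f -> measurable_fun setT (f : borel X -> R).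
Proof.
move=> /continuousP cf; apply: (@measurability _ _ (borel X) _ _ _ _ (RGenOpens.measurableE R)).
move=> _ [_ [a [b ->] <-]]; rewrite setTI; apply: sub_sigma_algebra.
by apply: cf; exact: interval_open.
Qed.

(** The preimage of an open set is the union of the events of the prefixes that already force the
    value into it, and finite words are countably many. *)
Lemma prefix_continuous_measurable (T : finType) d (W : measurableType d)
    (Z : W -> nat -> T) (G : (nat -> T) -> X) :
  (forall s, measurable [set w | past (Z w) (size s) = s]) ->
  (forall z V, nbhs (G z) V ->
    exists k, forall z', past z' k = past z k -> V (G z')) ->
  measurable_fun setT (G \o Z : W -> borel X).
Proof.
move=> mZ cG; apply: (@measurability _ _ _ (borel X) _ _ open) => // _ [V oV <-]; rewrite setTI.
pose D := [set s : seq T | forall z, past z (size s) = s -> V (G z)].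
have -> : (G \o Z) @^-1` V = \bigcup_(s in D) [set w | past (Z w) (size s) = s].
  apply/seteqP; split => w /=; last by case=> s sD; exact: sD.
  move=> VGZ; have [k Hk] := cG _ _ (open_nbhs_nbhs (conj oV VGZ)).
  by exists (past (Z w) k); rewrite /D /= size_past.
rewrite bigcup_mkcond; apply: countable_bigcupT_measurable => [|s].
  exact: countableP.
by case: ifPn.
Qed.

End borel_measurability.

(** * Convergence in initial and product topologies; continuity of evaluations *)

Lemma cvg_initial_topology (S : choiceType) (T : topologicalType) (f : S -> T)
    (F : set_system S) (s : S) : Filter F ->
  f @ F --> f s -> F --> (s : initial_topology f).
Proof.
move=> FF Ff U [?/= [[W oW <-]]] /= Wfs /filterS; apply; apply: Ff.
exact: open_nbhs_nbhs.
Qed.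

Lemma cvg_prod_topology (I : Type) (T : I -> topologicalType)
    (F : set_system (prod_topology T)) (s : prod_topology T) : Filter F ->
  (forall i, (fun f : prod_topology T => f i) @ F --> s i) -> F --> s.
Proof. by move=> FF Fs; apply/cvg_sup => i; exact: cvg_initial_topology. Qed.

Lemma coordinate_continuous (I : Type) (T : I -> topologicalType) (i : I) :
  continuous (fun f : prod_topology T => f i).
Proof.
move=> f U Uf; have /cvg_sup/(_ i) : f --> f by exact: cvg_id.
by apply; exact: (@initial_continuous _ _ (fun g : prod_topology T => g i)).
Qed.

Section evaluation.
Variables (R : realType) (T : pointedType).

(** On a discrete space every indicator is bounded and continuous, so the mass of [A] is one
    coordinate of [expectations]. *)
Lemma continuous_mass (A : set T) :
  continuous (fun m : M1 R (discrete T) => fine (m A)).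
Proof.
have [cA bA] : continuous (\1_A : discrete T -> R) /\ bounded_fun (\1_A : discrete T -> R).
  split; first by move=> x U /nbhs_singleton Ux;
    rewrite nbhs_filterE nbhs_principalE; apply/principal_filterP.
  exists 1; split=> // M M1 x _; apply: le_trans (ltW M1).
  by rewrite indicE; case: (x \in A); rewrite ?normr1 ?normr0.
pose f : bounded_continuous R (discrete T) := exist _ _ (conj cA bA).
have -> : (fun m : M1 R (discrete T) => fine (m A)) =
    (fun h => h f) \o @expectations R (discrete T).
  apply/funext => m; rewrite /expectations /= /Rintegral.
  by rewrite integral_indic ?setIT//; exact: measurable_discrete.
move=> m; apply: (@continuous_comp _ _ _ (@expectations R (discrete T)) (fun h => h f)).
  exact: (@initial_continuous _ _ (@expectations R (discrete T))).
exact: (@coordinate_continuous (bounded_continuous R (discrete T)) (fun=> R)).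
Qed.

Lemma sum_mass_preimage (m : probability (borel (discrete T)) R) (I : finType)
  (f : T -> I) (A : pred I) :
  \sum_(x | A x) fine (m (f @^-1` [set x])) = fine (m (f @^-1` [set x | A x])).
Proof.
have mB (B : set (borel (discrete T))) : measurable B by exact: measurable_discrete.
have -> : f @^-1` [set x | A x] =
   \bigcup_(x in [set` [seq x <- index_enum I | A x]]) (f @^-1` [set x]).
  apply/seteqP; split => a /=.
    by move=> Afa; exists (f a) => //=; rewrite mem_filter Afa mem_index_enum.
  by move=> [x /=]; rewrite mem_filter => /andP[Ax _] ->.
rewrite (@measure_fin_bigcup _ _ _ m I)//; last first.
  by move=> x y _ _ [z [/= -> ->]].
rewrite -fsbig_seq ?filter_uniq ?index_enum_uniq//=.
rewrite big_filter -[LHS]/(fine (_%:E)) -sumEFin; congr fine.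
by apply: eq_bigr => x _; rewrite fineK// fin_num_measure.
Qed.

End evaluation.

(** * Mixtures of pure profiles *)

Section purification.
Variables (R : realType) (N : nat).
Variables (O0 : pointedCountType) (Op : 'I_N -> pointedCountType).
Variable Ac : 'I_N -> pointedFinType.

Local Notation profile := (profile R O0 Op Ac).

Lemma measurable_profile_mass n t i (B : set (Ac n)) :
  measurable_fun setT (fun u : borel profile => fine ((u : profile) n t i B)).
Proof.
apply: (@continuous_real_measurable profile) => u.
apply: (@continuous_comp _ _ _ (fun u : profile => u n t i : M1 R (discrete (Ac n)))
  (fun m => fine (m B))); last exact: continuous_mass.
apply: (@continuous_comp _ _ _ (fun u : profile => u n) (fun v => v t i)).
  exact: coordinate_continuous.
apply: (@continuous_comp _ _ _ (fun v : policy R O0 Op Ac n => v t) (fun v => v i)).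
  exact: coordinate_continuous.
exact: coordinate_continuous.
Qed.

Lemma measurable_scripted_prob o b t :
  measurable_fun setT (fun u : borel profile => scripted_prob o b u t : R).
Proof.
apply: measurable_prod => s _; apply: measurable_prod => n _.
exact: measurable_profile_mass.
Qed.

(** Countable, so [pickle] numbers in advance all the draws that a pure profile requires. *)
Definition decision : countType :=
  {n : 'I_N & {t : nat & (information O0 Op Ac n t : countType)}}.

Definition decision_at n t i : decision :=
  existT _ n (existT (fun t => information O0 Op Ac n t : Type) t i).
Arguments decision_at : clear implicits.

Definition embed n (a : Ac n) : act Ac := finfun (dfwith (fun m => point : Ac m) n a).

Arguments embed : clear implicits.

Lemma embedE n a : embed n a n = a.
Proof. by rewrite ffunE dfwithin. Qed.

(* All decisions draw from the one alphabet [act Ac]; a decision of agent n only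
   uses the component n. Indices k that code no decision draw the constant [point]. *)
Definition decision_law (k : nat) (u : profile) (x : act Ac) : R :=
  if unpickle k is Some (existT n (existT t i))
  then fine (u n t i (embed n @^-1` [set x])) else (x == point)%:R.

Lemma decision_law_ge0 k u x : 0 <= decision_law k u x.
Proof.
rewrite /decision_law; case: unpickle => [[n [t i]]|]; last exact: ler0n.
exact: fine_ge0.
Qed.

Lemma measurable_decision_law k x :
  measurable_fun setT (fun u : borel profile => decision_law k u x).
Proof.
rewrite /decision_law; case: unpickle => [[n [t i]]|]; last exact: measurable_cst.
exact: measurable_profile_mass.
Qed.

Lemma sum_decision_law k u : \sum_x decision_law k u x = 1.
Proof.
rewrite /decision_law; case: unpickle => [[n [t i]]|].
  rewrite (sum_mass_preimage (u n t i) (embed n) xpredT).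
  rewrite (_ : [set _ | _] = setT) ?preimage_setT; last exact/seteqP.
  by rewrite probability_setT.
by rewrite (bigD1 point)//= eqxx big1 ?addr0// => x /negbTE ->.
Qed.

Lemma sum_decision_law_at n t i (u : profile) (a : Ac n) :
  \sum_(x : act Ac | x n == a) decision_law (pickle (decision_at n t i)) u x =
  fine (u n t i [set a]).
Proof.
rewrite /decision_law pickleK /=.
rewrite (sum_mass_preimage (u n t i) (embed n) (fun x : act Ac => x n == a)).
congr (fine (u n t i _)); apply/seteqP.
by split => c /=; rewrite embedE => /eqP.
Qed.

Definition pure_of_letters (z : nat -> act Ac) : profile :=
  fun n t i => dirac (z (pickle (decision_at n t i)) n : borel (discrete (Ac n))).

Lemma pure_of_lettersP z : pure_profile R O0 Op Ac (pure_of_letters z).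
Proof. by move=> n t i; exists (z (pickle (decision_at n t i)) n). Qed.

Definition pure_code (z : nat -> act Ac) : set_type (pure_profile R O0 Op Ac) :=
  SigSub (mem_set (pure_of_lettersP z)).

(** Convergence in the product is coordinatewise, and each coordinate reads a single letter, hence
    is constant on a long enough cylinder around [z]. *)
Lemma pure_code_continuous z V : nbhs (pure_code z) V ->
  exists k, forall z', past z' k = past z k -> V (pure_code z').
Proof.
(* The cylinders around [z] generate [F]; the claim is the convergence of [pure_code] along [F]. *)
pose F := filter_from [set: nat] (fun k => [set z' | past z' k = past z k]).
have FF : Filter F.
  apply: filter_from_filter; first by exists 0%N.
  move=> k l _ _; exists (maxn k l) => // z' /= e.
  by split; apply: eq_past => j jk; apply: past_eq e _; rewrite leq_max jk ?orbT.
suff H : pure_code @ F --> pure_code z by move=> /H [k _ Hk]; exists k.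
apply: cvg_initial_topology.
apply: cvg_prod_topology => n; apply: cvg_prod_topology => t.
apply: cvg_prod_topology => i U /nbhs_singleton Uz.
exists (pickle (decision_at n t i)).+1 => // z' /= e.
suff e' : @pure_of_letters z' n t i = @pure_of_letters z n t i.
  by change (U (@pure_of_letters z' n t i)); rewrite e'.
by rewrite /pure_of_letters (past_eq e).
Qed.

Section mixture_of_profiles.
Variable mu : probability (borel profile) R.

Let letters := mixture_process mu point decision_law.

Let measurable_pure_code :
  measurable_fun setT (pure_code \o letters : measurableTypeR R -> borel _).
Proof.
apply: prefix_continuous_measurable; last exact: pure_code_continuous.
exact: (measurable_past_mixture mu point measurable_decision_law
  decision_law_ge0 sum_decision_law).
Qed.

(** The measure is chosen before the script: a single law of pure profiles matches the mean for
    every finite play. *)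
Lemma purify : exists nu : M1 R (set_type (pure_profile R O0 Op Ac)),
  forall o b t, (\int[nu]_v (scripted_prob o b (set_val v) t)%:E =
                \int[mu]_u (scripted_prob o b u t)%:E)%E.
Proof.
pose f : {mfun measurableTypeR R >-> borel (set_type (pure_profile R O0 Op Ac))} :=
  HB.pack (pure_code \o letters) (isMeasurableFun.Build _ _ _ _ _ measurable_pure_code).
exists (distribution (@unit_lebesgue R) f) => o b t.
rewrite ge0_integral_distribution; last 2 first.
- apply/measurable_EFinP.
  apply: (measurableT_comp (measurable_scripted_prob o b t)).
  by apply: continuous_borel_measurable; exact: initial_continuous.
- by move=> v; rewrite lee_fin scripted_prob_ge0.
(* The factors of the play are indexed by pairs of a time and an agent; [kappa] is the position of
   the letter that a pair consults. The code contains both time and agent, so distinct pairs use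
   distinct draws. *)
pose J : finType := ('I_t * 'I_N)%type.
pose kappa (j : J) := pickle (decision_at j.2 j.1 (view j.2 (scripted_history o b j.1))).
have kappa_inj : injective kappa.
  move=> [s n] [s' n'] /(pcan_inj pickleK) e.
  have /= nn := congr1 tag e.
  have /= ss := congr1 (fun d : decision => tag (tagged d)) e.
  by congr (_, _) => //; exact: val_inj.
pose K := (\max_j kappa j).+1.
have kK j : (kappa j < K)%N by rewrite ltnS leq_bigmax.
(* Letter [k] must agree with the script at the pair coded by [k], and is free when [k] codes no
   pair of the play. *)
pose A k (x : act Ac) := [forall j : J, (kappa j == k) ==> (x j.2 == b j.1 j.2)].
pose E := [set w : measurableTypeR R | forall k, (k < K)%N -> A k (letters w k)].
have [mE E_mass] := mixture_process_unit mu point measurable_decision_law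
  decision_law_ge0 sum_decision_law A K.
(* Under a pure profile the play has weight 0 or 1: as a function of [w] it is the indicator of
   [E]. *)
transitivity (unit_lebesgue E).
  rewrite -[E]setIT -integral_indic//.
  apply: eq_integral => w _; congr (_%:E).
  rewrite /scripted_prob /action_prob pair_big /= indicE.
  have massE (j : J) :
      fine (@pure_of_letters (letters w) j.2 j.1 (view j.2 (scripted_history o b j.1))
        [set b j.1 j.2]) = (letters w (kappa j) j.2 == b j.1 j.2)%:R.
    rewrite [X in fine X](@diracE _ (borel (discrete (Ac j.2)))) /=.
    by congr ((nat_of_bool _)%:R); apply/idP/eqP; [rewrite inE|move=> e; apply/mem_set].
  rewrite (eq_bigr (fun j : J => (letters w (kappa j) j.2 == b j.1 j.2)%:R)); last first.
    by move=> j _; exact: massE.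
  case: (boolP (w \in E)) => [/set_mem Ew|/negP Ew].
    rewrite big1// => j _.
    by have /forallP/(_ j) := Ew _ (kK j); rewrite eqxx /= => ->.
  have [j /negbTE j0] : exists j : J, letters w (kappa j) j.2 != b j.1 j.2.
    apply: contrapT => Hj; apply: Ew; apply/mem_set => k _.
    apply/forallP => j; apply/implyP => /eqP <-; apply/negP => jb.
    by apply: Hj; exists j; apply/negP.
  by rewrite (bigD1 j)//= j0 mul0r.
rewrite [LHS]E_mass.
apply: eq_integral => u _; congr (_%:E).
rewrite /scripted_prob /action_prob pair_big /=.
(* The factors are regrouped by letter position; by injectivity of [kappa] each position below [K]
   receives at most one pair. *)
rewrite [RHS](partition_big (fun j : J => Ordinal (kK j)) xpredT)//=.
apply: eq_bigr => k _.
case: (pickP [pred j | kappa j == k]) => [j /= /eqP kj|k0].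
  rewrite (big_pred1 j) => [|j']; last first.
    by rewrite -(inj_eq val_inj) /= -kj (inj_eq kappa_inj).
  rewrite -[RHS]sum_decision_law_at -kj; apply: eq_bigl => x.
  apply/forallP/idP => [/(_ j)|xj j']; first by rewrite eqxx.
  by apply/implyP => /eqP/kappa_inj ->.
(* A free letter contributes its total mass 1, which matches the empty product. *)
rewrite [RHS]big_pred0 => [|j]; last by rewrite -(inj_eq val_inj) /=; exact: k0.
rewrite -(sum_decision_law k u); apply: eq_bigl => x.
by apply/forallP => j; rewrite [_ == _]k0.
Qed.

End mixture_of_profiles.

End purification.

(** * Equality of the two sets of occupation measures *)

Local Open Scope ereal_scope.

Theorem theorem4 (R : realType) (N : nat) (hN : (0 < N)%N)
    (S : ptopologicalType)
    (O0 : pointedCountType) (Op : 'I_N -> pointedCountType)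
    (Ac : 'I_N -> pointedFinType)
    (P1 : probability (borel S * borel (discrete (obs O0 Op)))%type R)
    (P : R.-pker (borel S * borel (discrete (act Ac)))%type
           ~> (borel S * borel (discrete (obs O0 Op)))%type) :
  [set occupation_mix P1 P mu | mu in [set: M1 R (profile R O0 Op Ac)]] =
  [set occupation_mix_pure P1 P mu |
    mu in [set: M1 R (set_type (pure_profile R O0 Op Ac))]].
Proof.
have mval : measurable_fun setT (set_val :
    borel (set_type (pure_profile R O0 Op Ac)) -> borel (profile R O0 Op Ac)).
  by apply: continuous_borel_measurable; exact: initial_continuous.
apply/seteqP; split => _ [mu _ <-].
  have [pmu puriE] := purify mu; exists pmu => //; apply/funext => i.
  (* The constant [C] leaves both integrals, and the remaining means agree by the choice of
     [pmu]. *)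
  have [ob [b [t [C [C0 occE]]]]] := occupation_scripted P1 P i.
  rewrite /occupation_mix_pure /occupation_mix.
  under eq_integral do rewrite occE EFinM.
  under [RHS]eq_integral do rewrite occE EFinM.
  have mW := @measurable_scripted_prob R _ _ _ _ ob b t.
  have mWval := measurableT_comp mW mval.
  rewrite !ge0_integralZl ?lee_fin ?puriE//.
  - by apply/measurable_EFinP.
  - by move=> u _; rewrite lee_fin scripted_prob_ge0.
  - by apply/measurable_EFinP; exact: mWval.
  - by move=> u _; rewrite lee_fin scripted_prob_ge0.
(* Conversely, a mixture of pure profiles is pushed forward along the inclusion, and a change of
   variables gives the same occupation measure. *)
pose f : {mfun borel (set_type (pure_profile R O0 Op Ac)) >-> borel (profile R O0 Op Ac)} :=
  HB.pack set_val (isMeasurableFun.Build _ _ _ _ _ mval).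
exists (distribution mu f : M1 R (profile R O0 Op Ac)) => //; apply/funext => i.
have [ob [b [t [C [C0 occE]]]]] := occupation_scripted P1 P i.
rewrite /occupation_mix ge0_integral_distribution//.
  under eq_fun do rewrite occE.
  by apply/measurable_EFinP; apply: measurable_funM => //; exact: measurable_scripted_prob.
by move=> u; rewrite occE lee_fin mulr_ge0// scripted_prob_ge0.
Qed.
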